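(* Let $E$ be a Banach lattice and $Y$ a Banach space. If either $E'$ has the positive Schur property or $Y$ has the Schur property, then every weakly compact operator from $E$ to $Y$ is disjoint weak Banach-Saks.
   Context: An operator is a bounded linear map; $E'$ is the topological dual of $E$, a Banach lattice under its dual norm and order. A sequence $(x_n)$ in a Banach lattice is disjoint if $|x_n|\wedge|x_m|=0$ for $n\ne m$. The Cesàro sequence of $(y_k)$ is $\left(\frac1m\sum_{k=1}^m y_k\right)_m$. An operator $T:E\to Y$ is disjoint weak Banach-Saks if for each disjoint weakly null sequence $(x_n)$ of $E$, $(T(x_n))$ has a subsequence whose Cesàro sequence is norm convergent in $Y$. A Banach space has the Schur property if every weakly convergent sequence is norm convergent. A Banach lattice has the positive Schur property if every weakly null sequence of positive elements is norm null. *)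

(* Defs.v *)
From HB Require Import structures.
From mathcomp Require Import all_boot all_order all_algebra.
From mathcomp Require Import all_classical all_reals all_analysis.
Import Order.TTheory GRing.Theory Num.Theory.
Import numFieldNormedType.Exports.

Set Implicit Arguments.
Unset Strict Implicit.
Unset Printing Implicit Defensive.

Local Open Scope classical_set_scope.
Local Open Scope ring_scope.

(** * Topological dual, with the operator norm *)

Section dual_space.
Variables (R : realType) (V : normedModType R).

Definition cont_linear : {pred V -> R^o} :=
  fun f => `[< linear f /\ continuous f >].

Record dual_space := DualSpace {
  dual_fun :> V -> R^o;
  dual_funP : dual_fun \in cont_linear }.

HB.instance Definition _ := [isSub for dual_fun].
HB.instance Definition _ := [Choice of dual_space by <:].

Lemma cont_linear_submod_closed : submod_closed cont_linear.
Proof.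
split=> [|a f g].
  rewrite inE; split; last exact: cst_continuous.
  by move=> a x y; rewrite /= scaler0 addr0.
rewrite !inE => -[lf cf] [lg cg]; split.
  move=> b x y /=; rewrite !fctE lf lg !scalerDr !scalerA mulrC.
  by rewrite -!addrA; congr +%R; rewrite addrCA.
move=> x; apply: (@continuousD _ _ _ (a \*: f) g); last exact: cg.
exact: (@continuousZr _ _ _ f a x (cf x)).
Qed.

HB.instance Definition _ :=
  GRing.isSubmodClosed.Build R (V -> R^o) cont_linear cont_linear_submod_closed.
HB.instance Definition _ := [SubChoice_isSubLmodule of dual_space by <:].

Implicit Types f g : dual_space.

Lemma dual_linear f : linear f.
Proof. by have := dual_funP f; rewrite inE => -[]. Qed.

Lemma dual_continuous f : continuous f.
Proof. by have := dual_funP f; rewrite inE => -[]. Qed.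

HB.instance Definition _ f :=
  GRing.isLinear.Build R V R^o _ (dual_fun f) (dual_linear f).

Definition dual_norm f : R := sup [set `|f x| | x in [set x : V | `|x| <= 1]].

Lemma dual_norm_has_sup f :
  has_sup [set `|f x| | x in [set x : V | `|x| <= 1]].
Proof.
split; first by exists `|f 0|; exists 0 => //=; rewrite normr0.
have /linear_bounded_continuous/bounded_funP/(_ 1)[M fM] := @dual_continuous f.
by exists M => _ [x /= x1 <-]; exact: fM.
Qed.

Lemma dual_norm_ge f x : `|x| <= 1 -> `|f x| <= dual_norm f.
Proof.
by move=> x1; apply: sup_upper_bound; [exact: dual_norm_has_sup|exists x].
Qed.

Lemma dual_norm_le f M :
  (forall x, `|x| <= 1 -> `|f x| <= M) -> dual_norm f <= M.
Proof.
move=> fM; apply: ge_sup; first by have [] := dual_norm_has_sup f.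
by move=> _ [x /= x1 <-]; exact: fM.
Qed.

Lemma dual_norm_bound f x : `|f x| <= dual_norm f * `|x|.
Proof.
have [->|x0] := eqVneq x 0; first by rewrite linear0 !normr0 mulr0.
have nx0 : 0 < `|x| by rewrite normr_gt0.
rewrite -ler_pdivrMr// mulrC -[X in X * _](@gtr0_norm _ (`|x|^-1)) ?invr_gt0//.
rewrite -[_ * _](normrZ (`|x|^-1) (f x)) -linearZ; apply: dual_norm_ge.
by rewrite normrZ gtr0_norm ?invr_gt0// mulVf// gt_eqF.
Qed.

Lemma dual_ler_normD f g : dual_norm (f + g) <= dual_norm f + dual_norm g.
Proof.
apply: dual_norm_le => x x1; rewrite (le_trans (ler_normD (f x) (g x)))//.
by rewrite lerD// dual_norm_ge.
Qed.

Lemma dual_normrZ (a : R) f : dual_norm (a *: f) = `|a| * dual_norm f.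
Proof.
have le b h : dual_norm (b *: h) <= `|b| * dual_norm h.
  apply: dual_norm_le => x x1; rewrite [X in X <= _](normrM b (h x)).
  by rewrite ler_wpM2l// dual_norm_ge.
apply/eqP; rewrite eq_le le/=.
have [->|a0] := eqVneq a 0.
  rewrite normr0 mul0r; apply: le_trans (dual_norm_ge _ (x := 0) _) => //.
  by rewrite normr0.
rewrite -ler_pdivlMl ?normr_gt0// -normfV.
by apply: le_trans (le _ _); rewrite scalerA mulVf// scale1r.
Qed.

Lemma dual_normr0_eq0 f : dual_norm f = 0 -> f = 0.
Proof.
move=> f0; apply: val_inj; apply/funext => x /=.
apply/normr0_eq0/eqP; rewrite -normr_le0 normr_id.
by rewrite (le_trans (dual_norm_bound f x))// f0 mul0r.
Qed.

HB.instance Definition _ := @Lmodule_isNormed.Build R dual_space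
  dual_norm dual_ler_normD dual_normrZ dual_normr0_eq0.

End dual_space.

(** * Weak topology: the coarsest topology making every [f : dual_space V]
    continuous *)

Section weak_space.
Variables (R : realType) (V : normedModType R).

Definition dual_eval (x : V) : {ptws dual_space V -> R^o} := fun f => f x.

Definition weak_space : Type := initial_topology dual_eval.

HB.instance Definition _ := Topological.on weak_space.

Definition weakly_cvg (x : nat -> V) (l : V) :=
  (x : nat -> weak_space) @ \oo --> (l : weak_space).

Lemma weakly_cvgP (x : nat -> V) (l : V) :
  weakly_cvg x l <-> forall f : dual_space V, f (x n) @[n --> \oo] --> f l.
Proof.
split=> [xl f|xl].
  have c1 : continuous (dual_eval : weak_space -> _).
    exact: initial_continuous.
  have c2 := @proj_continuous (dual_space V) (fun=> R^o) f.
  have xl' := @cvg_comp _ _ _ (x : nat -> weak_space) dual_eval _ _ _ xl (c1 l).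
  exact: (cvg_comp _ _ xl' (c2 (dual_eval l))).
have {}xl : dual_eval \o x @ \oo --> dual_eval l.
  apply/cvg_sup => f; apply/cvg_image.
    by rewrite eqEsubset; split=> // r _; exists (fun=> r).
  move=> A /xl xA; exists [set h | A (h f)] => //.
  by rewrite eqEsubset; split=> [_ [h Ah <-]//|r Ar]; exists (fun=> r).
move=> A /= [_ [[B oB <-] Bl BA]].
have /xl xB : nbhs (dual_eval l) B by exact: open_nbhs_nbhs.
by apply: (@filterS _ (nbhs \oo) _ _ _ _ xB) => n /= Bn; exact: BA.
Qed.

End weak_space.

(** * Banach lattices *)

(* The order is not an [Order.POrder] instance: MathComp's numeric domains
   already inherit from both the order and the norm hierarchies, and HB does
   not accept a later structure joining a norm with an order. *)
HB.mixin Record isOrderedLmodule (R : realType) E & GRing.Lmodule R E := {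
  vle : E -> E -> Prop ;
  vle_refl : forall x, vle x x ;
  vle_anti : forall x y, vle x y -> vle y x -> x = y ;
  vle_trans : forall y x z, vle x y -> vle y z -> vle x z ;
  vleD2r : forall z x y, vle x y -> vle (x + z) (y + z) ;
  vleZ2l : forall (a : R) x y, 0 <= a -> vle x y -> vle (a *: x) (a *: y)
}.

#[short(type="orderedNormedModType")]
HB.structure Definition OrderedNormedModule (R : realType) :=
  {E of NormedModule R E & isOrderedLmodule R E}.

(* [vsup x (- x)] is the absolute value of [x]. *)
HB.mixin Record isNormedLattice (R : realType) E
    & OrderedNormedModule R E := {
  vsup : E -> E -> E ;
  vinf : E -> E -> E ;
  vsup_leP : forall x y z, vle (vsup x y) z <-> vle x z /\ vle y z ;
  vle_infP : forall x y z, vle z (vinf x y) <-> vle z x /\ vle z y ;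
  lattice_norm : forall x y,
    vle (vsup x (- x)) (vsup y (- y)) -> `|x| <= `|y|
}.

#[short(type="banachLatticeType")]
HB.structure Definition BanachLattice (R : realType) :=
  {E of CompleteNormedModule R E & OrderedNormedModule R E &
        isNormedLattice R E}.

Definition vabs (R : realType) (E : banachLatticeType R) (x : E) : E :=
  vsup x (- x).

(** ** Order of the dual of a Banach lattice *)

Section dual_order.
Variables (R : realType) (E : banachLatticeType R).
Implicit Types f g h : dual_space E.

Definition dual_le f g := forall x : E, vle 0 x -> f x <= g x.

Lemma dual_le_refl f : dual_le f f.
Proof. by []. Qed.

(* Every [x : E] is a difference of two positive elements. *)
Lemma dual_le_anti f g : dual_le f g -> dual_le g f -> f = g.
Proof.
move=> fg gf.
have eq_pos x : vle 0 x -> f x = g x.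
  by move=> x0; apply/eqP; rewrite eq_le fg// gf.
apply: val_inj; apply/funext => x /=.
have [x_le p0] := (vsup_leP x 0 _).1 (vle_refl (vsup x 0)).
have n0 : vle 0 (vsup x 0 - x).
  by have := vleD2r (- x) _ _ x_le; rewrite subrr.
rewrite -[x](subKr (vsup x 0)).
by rewrite (linearB f) (linearB g)/= (eq_pos _ p0) (eq_pos _ n0).
Qed.

Lemma dual_le_trans g f h : dual_le f g -> dual_le g h -> dual_le f h.
Proof. by move=> fg gh x x0; exact: le_trans (fg x x0) (gh x x0). Qed.

Lemma dual_leD2r h f g : dual_le f g -> dual_le (f + h) (g + h).
Proof. by move=> fg x x0; exact: lerD (fg x x0) (lexx (h x)). Qed.

Lemma dual_leZ2l (a : R) f g :
  0 <= a -> dual_le f g -> dual_le (a *: f) (a *: g).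
Proof. by move=> a0 fg x x0; exact: ler_wpM2l (fg x x0). Qed.

HB.instance Definition _ := isOrderedLmodule.Build R (dual_space E)
  dual_le_refl dual_le_anti dual_le_trans dual_leD2r dual_leZ2l.

End dual_order.

(** * Schur and Banach-Saks properties *)

Definition schur (R : realType) (V : normedModType R) :=
  forall (x : nat -> V) (l : V), weakly_cvg x l -> cvgn x.

(* The positive Schur property of a Banach lattice involves only its norm and
   its order, and is stated for any ordered normed space. *)
Definition positive_schur (R : realType) (E : orderedNormedModType R) :=
  forall x : nat -> E, (forall n, vle 0 (x n)) -> weakly_cvg x 0 ->
    x @ \oo --> (0 : E).

Definition disjoint_seq (R : realType) (E : banachLatticeType R)
    (x : nat -> E) :=
  forall n m, n != m -> vinf (vabs (x n)) (vabs (x m)) = 0.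

Definition cesaro_seq (R : realType) (V : normedModType R) (y : nat -> V) :
  nat -> V := fun m => m.+1%:R^-1 *: \sum_(0 <= k < m.+1) y k.

Definition bounded_operator (R : realType) (V W : normedModType R)
    (T : {linear V -> W}) :=
  exists M : R, forall x, `|T x| <= M * `|x|.

(* The image of the closed unit ball is relatively compact for the weak
   topology. *)
Definition weakly_compact_operator (R : realType) (V W : normedModType R)
    (T : {linear V -> W}) :=
  bounded_operator T /\
  compact (closure (T @` [set x : V | `|x| <= 1] : set (weak_space W))).

Definition disjoint_weak_banach_saks (R : realType)
    (E : banachLatticeType R) (Y : normedModType R) (T : {linear E -> Y}) :=
  bounded_operator T /\
  forall x : nat -> E, disjoint_seq x -> weakly_cvg x 0 ->
    exists s : nat -> nat, {homo s : m n / (m < n)%N} /\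
      cvgn (cesaro_seq (fun k => T (x (s k)))).

(* Main.v *)
From HB Require Import structures.
Require Import Defs.
From mathcomp Require Import all_boot all_order all_algebra.
From mathcomp Require Import all_classical all_reals all_analysis.
From mathcomp Require Import lra ring.

(** If [Y] has the Schur property, a weakly null sequence is mapped by [T] to a
    weakly null sequence, hence to a norm convergent one, whose Cesaro means
    converge.

    Suppose that the dual of [E] has the positive Schur property. Then
    [T (x n)] even tends to zero in norm for every disjoint weakly null
    sequence [x]. Such a sequence is bounded ([weakly_null_bounded]), and after
    splitting into positive and negative parts its terms may be taken positive
    ([weakly_compact_disjoint_null]). Choose [g n] in the unit ball of the dual
    of [Y] with [g n (T (x n)) = `|T (x n)|], and let [h n] be the part of
    the positive part of [g n \o T] carried by the ideal generated by [x n]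
    ([ideal_functional]). The [h n] are positive functionals with
    [h n (x n) >= `|T (x n)|], so by the positive Schur property it suffices
    that they are weakly null.

    If they are not, a functional on the dual of [E] is bounded away from zero
    on a subsequence of [h]. By [goldstine] there are, for each [N], an element
    [v N] of the unit ball of [E] on which the first [N] functionals of that
    subsequence are all bounded away from zero, hence elements [z N k] between
    [0] and the absolute value of [v N], in the ideals of distinct [x n], on
    which the corresponding [g n \o T] are bounded away from zero. For a fixed
    [N] the [z N k] are disjoint, so that their sums stay below the absolute
    value of [v N] and have norm at most 1. [weakly_compact_no_c0] shows that
    this contradicts the weak compactness of [T], by exchanging two limits
    along an ultrafilter. *)

Import Order.TTheory GRing.Theory Num.Theory.
Import numFieldNormedType.Exports.

Set Implicit Arguments.
Unset Strict Implicit.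
Unset Printing Implicit Defensive.

Local Open Scope classical_set_scope.
Local Open Scope ring_scope.

(** * The Hahn-Banach theorem *)

Section hahn_banach.
Variables (R : realType) (V : lmodType R).
Implicit Types (p q : V -> R) (x y : V).

(** Subadditive and positively homogeneous functions. The inequality for
    positive scalars suffices: applied to the inverse scalar it gives the
    equality. *)
Definition sublinear p :=
  (forall x y, p (x + y) <= p x + p y) /\
  (forall (a : R) x, 0 < a -> p (a *: x) <= a * p x).

Lemma sublinear0 p : sublinear p -> p 0 = 0.
Proof.
move=> [_ pZ].
have := pZ 2 0 ltac:(lra); have := pZ 2^-1 0 ltac:(lra).
by rewrite !scaler0 => *; lra.
Qed.

Lemma sublinearZ p (a : R) x : sublinear p -> 0 <= a -> p (a *: x) = a * p x.
Proof.
move=> sp; rewrite le_eqVlt => /predU1P[<-|a0].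
  by rewrite scale0r mul0r sublinear0.
apply/eqP; rewrite eq_le sp.2//= -ler_pdivlMl//.
by rewrite -{1}[x](@scalerK _ _ a) ?sp.2 ?invr_gt0 ?gt_eqF.
Qed.

Lemma sublinearN_le p x : sublinear p -> - p (- x) <= p x.
Proof.
move=> sp; have := sp.1 (- x) x; rewrite addNr (sublinear0 sp); lra.
Qed.

Let tilts q y x := [set q (x + t *: y) - t * q y | t in [set t | 0 <= t]].

(** A sublinear function below [q] whose value at [- y] is at most [- q y]; a
    minimal sublinear function is its own tilt in every direction, hence odd. *)
Definition tilt q y x := inf (tilts q y x).

Let has_inf_tilts q y x : sublinear q -> has_inf (tilts q y x).
Proof.
move=> sq; split.
  by exists (q (x + 0 *: y) - 0 * q y); exists 0 => /=.
exists (- q (- x)) => _ [t /= t0 <-].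
rewrite lerBrDl -lerBrDr opprK -(sublinearZ y sq t0).
by have := sq.1 (x + t *: y) (- x); rewrite addrAC subrr add0r.
Qed.

Let tilt_le_at q y x t : sublinear q -> 0 <= t ->
  tilt q y x <= q (x + t *: y) - t * q y.
Proof.
by move=> sq t0; apply: ge_inf; [exact: (has_inf_tilts _ _ sq).2|exists t].
Qed.

Lemma tilt_le q y x : sublinear q -> tilt q y x <= q x.
Proof.
by move=> sq; have := tilt_le_at y x sq (lexx 0); rewrite scale0r mul0r addr0 subr0.
Qed.

Lemma tiltN q y : sublinear q -> tilt q y (- y) <= - q y.
Proof.
move=> sq; have := tilt_le_at y (- y) sq ler01.
by rewrite scale1r mul1r addNr (sublinear0 sq) sub0r.
Qed.

Lemma tilt_sublinear q y : sublinear q -> sublinear (tilt q y).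
Proof.
move=> sq; split=> [x x'|a x a0].
- rewrite -lerBlDr; apply: (lb_le_inf (has_inf_tilts _ _ sq).1).
  move=> _ [s /= s0 <-]; rewrite lerBlDr [leRHS]addrC -lerBlDr.
  apply: (lb_le_inf (has_inf_tilts _ _ sq).1).
  move=> _ [t /= t0 <-]; rewrite lerBlDr.
  apply: (le_trans (tilt_le_at y (x + x') sq (addr_ge0 s0 t0))).
  have := sq.1 (x + s *: y) (x' + t *: y); rewrite addrACA -scalerDl; lra.
- rewrite -ler_pdivrMl//; apply: (lb_le_inf (has_inf_tilts _ _ sq).1).
  move=> _ [t /= t0 <-]; rewrite ler_pdivrMl//.
  apply: (le_trans (tilt_le_at y (a *: x) sq (mulr_ge0 (ltW a0) t0))).
  by rewrite -scalerA -scalerDr (sublinearZ _ sq (ltW a0)) mulrBr mulrA.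
Qed.

(** The pointwise infimum of a nonempty chain of sublinear functions below [p]
    is sublinear; it is finite because every such function is bounded below by
    [- p (- x)] at [x]. *)
Let chain_inf p (A : set {q : V -> R | sublinear q /\ (forall x, q x <= p x)}) :
  A !=set0 ->
  total_on A (fun c c' => `[< forall x, sval c' x <= sval c x >]) ->
  exists q, [/\ sublinear q, (forall x, q x <= p x) &
    forall c, A c -> forall x, q x <= sval c x].
Proof.
move=> [q0 Aq0] totA.
pose S x := [set sval c x | c in A].
have hS x : has_inf (S x).
  split; first by exists (sval q0 x); exists q0.
  exists (- p (- x)) => _ [[q [sq qp]] /= _ <-].
  by apply: le_trans (sublinearN_le x sq); rewrite lerN2.
have leS c x : A c -> inf (S x) <= sval c x.
  by move=> Aq; apply: ge_inf; [exact: (hS x).2|exists c].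
exists (fun x => inf (S x)); split; last by move=> c Ac x; exact: leS.
- split=> [x y|a x a0].
    rewrite -lerBlDr; apply: (lb_le_inf (hS x).1).
    move=> _ [q Aq <-]; rewrite lerBlDr [leRHS]addrC -lerBlDr.
    apply: (lb_le_inf (hS y).1).
    move=> _ [q' Aq' <-]; rewrite lerBlDr.
    have [/asboolP qq|/asboolP qq] := totA _ _ Aq Aq'.
      apply: (le_trans (leS q' (x + y) Aq')).
      have := (svalP q').1.1 x y; have := qq x; lra.
    apply: (le_trans (leS q (x + y) Aq)).
    have := (svalP q).1.1 x y; have := qq y; lra.
  rewrite -ler_pdivrMl//; apply: (lb_le_inf (hS x).1).
  move=> _ [q Aq <-]; rewrite ler_pdivrMl//.
  by apply: (le_trans (leS q _ Aq)); exact: (svalP q).1.2.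
- by move=> x; apply: (le_trans (leS _ _ Aq0)); exact: (svalP q0).2.
Qed.

Lemma minimal_sublinear p : sublinear p ->
  exists q, [/\ sublinear q, (forall x, q x <= p x) &
    forall q', sublinear q' -> (forall x, q' x <= q x) -> q' = q].
Proof.
move=> sp.
pose T := {q : V -> R | sublinear q /\ (forall x, q x <= p x)}.
pose r (c c' : T) := `[< forall x, sval c' x <= sval c x >].
have pT : sublinear p /\ (forall x, p x <= p x) by [].
have [||||[q [sq qp]] qmin] := @Zorn T r.
- by move=> t; apply/asboolP.
- move=> s t u /asboolP st /asboolP tu; apply/asboolP => x.
  exact: le_trans (tu x) (st x).
- move=> [s sP] [t tP] /asboolP /= st /asboolP /= ts; apply: eq_exist.
  by apply/funext => x; apply/eqP; rewrite eq_le st ts.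
- move=> A totA; have [A0|A0] := pselect (A !=set0).
    have [q [sq qp qA]] := chain_inf A0 totA.
    exists (exist _ q (conj sq qp)) => s As; apply/asboolP => x; exact: qA.
  exists (exist _ p pT) => s As; exfalso; apply: A0; by exists s.
exists q; split=> // q' sq' q'q.
have q'p x : q' x <= p x by exact: le_trans (q'q x) (qp x).
have rqq' : r (exist _ q (conj sq qp)) (exist _ q' (conj sq' q'p)).
  exact/asboolP.
exact: (congr1 sval (qmin _ rqq')).
Qed.

(** The Hahn-Banach theorem, with equality at a prescribed vector: a minimal
    sublinear function below the tilt of [p] in the direction [v] is linear, and
    is at most [- p v] at [- v]. *)
Theorem hahn_banach_sublinear p (v : V) : sublinear p ->
  exists f : {linear V -> R^o}, (forall x, f x <= p x) /\ f v = p v.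
Proof.
move=> sp; have stp := tilt_sublinear v sp.
have [q [sq qle qmin]] := minimal_sublinear stp.
have qp x : q x <= p x by exact: le_trans (qle x) (tilt_le v x sp).
have qN y : q (- y) = - q y.
  apply/eqP; rewrite eq_le; apply/andP; split; last first.
    by rewrite lerNl -[leRHS]opprK opprK; exact: sublinearN_le.
  rewrite -{1}(qmin _ (tilt_sublinear y sq)); first exact: tiltN.
  by move=> x; exact: tilt_le.
have qD x y : q (x + y) = q x + q y.
  apply/eqP; rewrite eq_le sq.1/=.
  by have := sq.1 (x + y) (- y); rewrite addrK qN lerBrDr.
have qZ (a : R) x : q (a *: x) = a * q x.
  have [a0|a0] := leP 0 a; first exact: sublinearZ.
  have := sublinearZ x sq (_ : 0 <= - a); rewrite scaleNr qN mulNr.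
  by rewrite oppr_ge0 (ltW a0) => /(_ isT)/oppr_inj.
have lq : linear (q : V -> R^o) by move=> a x y; rewrite qD qZ.
pose qL : {linear V -> R^o} :=
  HB.pack (q : V -> R^o) (GRing.isLinear.Build R V R^o _ _ lq).
exists qL.
split=> //=; apply/eqP; rewrite eq_le qp/=.
by rewrite -lerN2 -qN; exact: le_trans (qle _) (tiltN v sp).
Qed.

End hahn_banach.

(** * The dual space *)

Section dual_lemmas.
Variables (R : realType) (V : normedModType R).
Implicit Types (g : dual_space V).

Lemma dual_of_bounded (f : {linear V -> R^o}) (C : R) : 0 <= C ->
  (forall x, `|f x| <= C * `|x|) ->
  exists g, (forall x, g x = f x) /\ `|g| <= C.
Proof.
move=> C0 fC.
have cf : continuous f.
  apply/linear_bounded_continuous/bounded_funP => r; exists (C * r) => x xr.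
  by apply: (le_trans (fC x)); exact: ler_wpM2l.
have fP : (f : V -> R^o) \in @cont_linear R V.
  by rewrite inE; split=> //; exact: linearP.
exists (DualSpace fP); split=> //.
apply: dual_norm_le => x x1; apply: (le_trans (fC x)).
by rewrite -[leRHS]mulr1; exact: ler_wpM2l.
Qed.

Lemma dual_norming (x : V) : exists g, `|g| <= 1 /\ g x = `|x|.
Proof.
have sn : sublinear (fun y : V => `|y|).
  by split=> [y z|a y a0]; [exact: ler_normD|rewrite normrZ gtr0_norm].
have [f [fle fx]] := hahn_banach_sublinear x sn.
have fb y : `|f y| <= 1 * `|y|.
  rewrite mul1r ler_norml fle andbT lerNl -(normrN y).
  by have := fle (- y); rewrite linearN.
have [g [gf g1]] := dual_of_bounded ler01 fb.
by exists g; rewrite gf.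
Qed.

(** A pointwise limit of functionals, along any proper filter, is a functional
    if the norms are eventually bounded. *)
Lemma dual_pointwise_lim (I : Type) (F : set_system I) (g : I -> dual_space V)
    (C : R) : ProperFilter F -> 0 <= C ->
  (\forall i \near F, `|g i| <= C) ->
  (forall x, cvg ((g i x : R^o) @[i --> F])) ->
  exists G : dual_space V, `|G| <= C /\ forall x, g i x @[i --> F] --> G x.
Proof.
move=> FF C0 gC gcvg.
pose L x : R^o := lim ((g i x : R^o) @[i --> F]).
have LP x : (g i x : R^o) @[i --> F] --> L x by exact: gcvg.
have lL : linear L.
  move=> a x y; apply: cvg_lim => //.
  rewrite (_ : (fun i => _) = (fun i => a *: (g i x : R^o) + g i y)).
    by apply: cvgD; [apply: cvgZr; exact: LP|exact: LP].
  by apply/funext => i; rewrite linearP.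
pose f : {linear V -> R^o} := HB.pack L (GRing.isLinear.Build R V R^o _ _ lL).
have fb x : `|f x| <= C * `|x|.
  apply: (@cvgr_to_le _ F _ _ (fun i => `|(g i x : R^o)|)).
    by apply: cvg_norm; exact: LP.
  near=> i; apply: (le_trans (dual_norm_bound (g i) x)).
  by apply: ler_wpM2r => //; near: i.
have [G [GL GC]] := dual_of_bounded C0 fb.
by exists G; split=> // x; rewrite GL; exact: LP.
Unshelve. all: by end_near. Qed.

Lemma dual_complete (F : set_system (dual_space V)) :
  ProperFilter F -> cauchy F -> cvg F.
Proof.
move=> FF /cauchyP Fc.
have near_ctr e : 0 < e -> exists g0 : dual_space V, \forall g \near F, `|g0 - g| < e.
  by move=> /Fc[g0 Fg0]; exists g0; move: Fg0; rewrite -ball_normE.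
have cvgx x : cvg ((g x : R^o) @[g --> F]).
  apply/cauchy_cvgP/cauchy_exP => e e0.
  have e'0 : 0 < e / (`|x| + 1) by rewrite divr_gt0// ltr_wpDl.
  have [g0 Fg0] := near_ctr _ e'0; exists (g0 x).
  rewrite -ball_normE /ball_ /fmap/=; apply: filterS Fg0 => g /= g0g.
  have /le_lt_trans := dual_norm_bound (g0 - g) x; apply.
  rewrite ltr_pdivlMr ?ltr_wpDl// in g0g.
  apply: le_lt_trans g0g; apply: ler_wpM2l; last by rewrite lerDl.
  exact: (normr_ge0 (g0 - g)).
have [g1 Fg1] := near_ctr 1 ltr01.
have FC : \forall g \near F, `|g| <= 1 + `|g1|.
  apply: filterS Fg1 => g g1g; rewrite -[g in leLHS](subKr g1).
  by rewrite (le_trans (ler_normB _ _))// addrC lerD2r ltW.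
have [|G [_ GP]] := dual_pointwise_lim FF _ FC cvgx; first by rewrite addr_ge0.
apply/cvg_ex; exists G; apply/cvgrPdist_le => e e0.
have e20 : 0 < e / 2 by rewrite divr_gt0.
have [g0 Fg0] := near_ctr _ e20.
have g0G : `|g0 - G| <= e / 2.
  apply: dual_norm_le => x x1.
  apply: (@cvgr_to_le _ F _ _ (fun g => `|g0 x - g x : R^o|)).
    by apply: cvg_norm; apply: cvgB; [exact: cvg_cst|exact: GP].
  apply: filterS Fg0 => g g0g.
  by apply: le_trans (ltW g0g); exact: (dual_norm_ge (g0 - g) x1).
apply: filterS Fg0 => g g0g.
rewrite (_ : G - g = - (g0 - G) + (g0 - g)); last by rewrite opprB addrA subrK.
rewrite (le_trans (ler_normD _ _))// normrN [leRHS]splitr.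
by apply: lerD => //; exact: ltW.
Qed.

HB.instance Definition _ :=
  Uniform_isComplete.Build (dual_space V) dual_complete.

(** The evaluations at the terms of a weakly null sequence form a pointwise
    bounded family of functionals on the dual, which is complete; the uniform
    boundedness principle bounds them on the unit ball of the dual. *)
Lemma weakly_null_bounded (x : nat -> V) : weakly_cvg x 0 ->
  exists2 M, 0 <= M & forall n, `|x n| <= M.
Proof.
move=> /weakly_cvgP x0.
pose ev n (g : dual_space V) : R^o := g (x n).
have [|g|M MP] := @Banach_Steinhauss R (dual_space V) R^o (range ev) _ _ 1.
- move=> _ [n _ <-]; split; last by [].
  move=> r; exists (r * `|x n|) => g gr.
  apply: (le_trans (dual_norm_bound g (x n))).
  by apply: ler_wpM2r.
- have /cvg_seq_bounded[M [_ MP]] : cvgn (fun n => (g (x n) : R^o)).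
    by apply/cvg_ex; exists (g 0); exact: x0.
  exists (M + 1) => _ [n _ <-]; apply: MP => //; lra.
have xM n : `|x n| <= M.
  have [g [g1 gx]] := dual_norming (x n).
  rewrite -[`|x n|]ger0_norm// -gx; apply: (MP (ev n)) => //; by exists n.
by exists M => //; apply: le_trans (xM 0).
Qed.

End dual_lemmas.

(** * Limits along ultrafilters *)

Section ultrafilter_limits.

Lemma fmap_ultra (I J : Type) (f : I -> J) (U : set_system I) :
  UltraFilter U -> UltraFilter (f @ U).
Proof.
move=> UU; split; first exact: fmap_proper_filter.
move=> G GG UG; apply/seteqP; split=> // A GA.
have [//|UA] := in_ultra_setVsetC (f @^-1` A) UU.
have : G (~` A) by exact: UG.
by move=> /(filterI GA); rewrite setICr => /filter_not_empty.
Qed.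

Lemma ultra_bounded_cvg (R : realType) (I : Type) (U : set_system I)
    (f : I -> R) (C : R) : UltraFilter U -> (forall i, `|f i| <= C) ->
  cvg (f @ U).
Proof.
move=> UU fC; have := @segment_compact R (- C) C; rewrite compact_ultra.
move=> /(_ (f @ U) (fmap_ultra f UU))[|l [_ fl]].
  by apply: (@filterS _ U _ setT) filterT => i _ /=; rewrite in_itv/= -ler_norml.
by apply/cvg_ex; exists l.
Qed.

(** The Banach-Alaoglu theorem, for a family of functionals and an
    ultrafilter. *)
Lemma ultra_dual_lim (R : realType) (V : normedModType R) (I : Type)
    (U : set_system I) (g : I -> dual_space V) (C : R) :
  UltraFilter U -> 0 <= C -> (forall i, `|g i| <= C) ->
  exists G : dual_space V, forall x, g i x @[i --> U] --> G x.
Proof.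
move=> UU C0 gC.
have [|x|G [_ GP]] := @dual_pointwise_lim R V I U g C _ C0; last by exists G.
  exact: nearW.
apply: (@ultra_bounded_cvg _ _ _ _ (C * `|x|)) => i.
by apply: (le_trans (dual_norm_bound (g i) x)); exact: (ler_wpM2r (normr_ge0 x) (gC i)).
Qed.

(** A weakly compact set contains a weak limit of each of its families along an
    ultrafilter. *)
Lemma weak_compact_ultra_lim (R : realType) (V : normedModType R) (I : Type)
    (U : set_system I) (K : set (weak_space V)) (y : I -> V) :
  UltraFilter U -> compact K -> (forall i, K (y i)) ->
  exists l : V, K l /\ forall g : dual_space V, g (y i) @[i --> U] --> g l.
Proof.
move=> UU; rewrite compact_ultra => Kc Ky.
have [|l [Kl yl]] := Kc _ (fmap_ultra (y : I -> weak_space V) UU).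
  by apply: (@filterS _ U _ setT) filterT => i _; exact: Ky.
exists l; split=> // g.
have c1 : continuous (@dual_eval R V : weak_space V -> _).
  exact: initial_continuous.
have c2 := @proj_continuous (dual_space V) (fun=> R^o) g.
have yl' := cvg_comp _ _ yl (c1 l).
exact: (cvg_comp _ _ yl' (c2 (dual_eval l))).
Qed.

End ultrafilter_limits.

(** * Goldstine's theorem *)

Lemma dual_lincomb (R : realType) (V : normedModType R) (g : dual_space V) n
    (r : 'I_n -> R) (h : 'I_n -> V) :
  g (\sum_k r k *: h k) = \sum_k r k * g (h k).
Proof. by rewrite linear_sum; apply: eq_bigr => k _; rewrite linearZ. Qed.

Section goldstine.
Variables (R : realType) (V : normedModType R).

Lemma dual_norm_adherent (g : dual_space V) (e : R) : 0 < e ->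
  exists2 y, `|y| <= 1 & `|g| - e < g y.
Proof.
move=> e0.
have [_ [y /= y1 <-] gy] := sup_adherent e0 (dual_norm_has_sup g).
have [g0|g0] := leP 0 (g y); first by exists y => //; rewrite ger0_norm in gy.
exists (- y); first by rewrite normrN.
by rewrite linearN/= -[X in _ < X]ler0_norm// ltW.
Qed.

Lemma dual_lincombE n (r : 'I_n -> R) (h : 'I_n -> dual_space V) x :
  (\sum_k r k *: h k) x = \sum_k r k * h k x.
Proof.
pose ev (g : dual_space V) : R^o := g x.
have lev : linear ev by [].
pose L : {linear dual_space V -> R^o} :=
  HB.pack ev (GRing.isLinear.Build R _ _ _ ev lev).
rewrite -[LHS]/(L _) linear_sum.
by apply: eq_bigr => k _; rewrite linearZ.
Qed.

(** The infimum [d] over the unit ball of the squared Euclidean distance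
    [phi x] from [(F (h k))_k] to [(h k x)_k] is zero. Let [r] be the residual
    at a near-minimiser [x] and [G] the combination of the [h k] with
    coefficients [r k]. As [F G <= `|G|], some [y] in the ball has [G y] nearly
    as large as [F G], and a small step from [x] towards [y] decreases [phi] by
    a definite amount if [d] is positive. *)
Lemma goldstine_sum (F : dual_space (dual_space V)) n
    (h : 'I_n -> dual_space V) (e : R) :
  `|F| <= 1 -> 0 < e ->
  exists2 x, `|x| <= 1 & \sum_k (F (h k) - h k x) ^+ 2 < e.
Proof.
move=> F1 e0; pose phi x := \sum_k (F (h k) - h k x) ^+ 2.
pose S := [set phi x | x in [set x | `|x| <= 1]].
have phi0 x : 0 <= phi x by apply: sumr_ge0 => k _; exact: sqr_ge0.
have hS : has_inf S.
  split; first by exists (phi 0); exists 0 => //=; rewrite normr0.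
  by exists 0 => _ [x _ <-].
have infS x : `|x| <= 1 -> inf S <= phi x.
  by move=> x1; apply: ge_inf; [exact: hS.2|exists x].
set d := inf S in infS *.
have adh t : 0 < t -> exists2 x, `|x| <= 1 & phi x < d + t.
  by move=> /inf_adherent/(_ hS)[_ [x x1 <-]]; exists x.
have [de|ed] := ltP d e.
  have := adh (e - d); rewrite subr_gt0 => /(_ de)[x x1 xe].
  by exists x => //; apply: lt_le_trans xe _; rewrite addrC subrK.
exfalso; have d0 : 0 < d by exact: lt_le_trans e0 ed.
pose M : R := \sum_k (2 * `|h k|) ^+ 2.
have M0 : 0 <= M by apply: sumr_ge0 => k _; exact: sqr_ge0.
(* the length of the step from [x] towards [y] *)
have [t [t0 t1 tE]] : exists t : R, [/\ 0 < t, t <= 1 & t * (2 * M + d) = d].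
  have Md : 0 < 2 * M + d by rewrite ltr_wpDl// mulr_ge0.
  exists (d / (2 * M + d)); rewrite divr_gt0// divfK ?gt_eqF//; split=> //.
  by rewrite ler_pdivrMr// mul1r lerDr mulr_ge0.
have td0 : 0 < t * d by rewrite mulr_gt0.
have [|x x1 xd] := adh (t * d / 2); first lra.
pose r k := F (h k) - h k x.
pose G := \sum_k r k *: h k.
have FG : F G <= `|G|.
  apply: (le_trans (ler_norm _)); apply: (le_trans (dual_norm_bound F G)).
  by rewrite -[leRHS]mul1r; exact: ler_wpM2r.
have [|y y1 Gy] := @dual_norm_adherent G (d / 4); first lra.
have GyE : G y = \sum_k r k * h k y by exact: dual_lincombE.
have FGE : F G = \sum_k r k * F (h k) by exact: dual_lincomb.
pose x' := x + t *: (y - x).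
have x'_le1 : `|x'| <= 1.
  have -> : x' = (1 - t) *: x + t *: y.
    by rewrite /x' scalerBr scalerBl scale1r addrA addrAC.
  have t'0 : 0 <= 1 - t by rewrite subr_ge0.
  apply: (le_trans (ler_normD _ _)).
  rewrite !normrZ (ger0_norm t'0) (ger0_norm (ltW t0)).
  have := ler_wpM2l t'0 x1; have := ler_wpM2l (ltW t0) y1; lra.
pose D k := h k y - h k x.
have phix' : phi x' = phi x - 2 * t * (\sum_k r k * D k) + t ^+ 2 * \sum_k D k ^+ 2.
  rewrite /phi !mulr_sumr -sumrB -big_split/=; apply: eq_bigr => k _.
  rewrite /x' linearD linearZ linearB /= /r /D -[t *: _]/(t * _).
  by ring.
have DM : \sum_k D k ^+ 2 <= M.
  apply: ler_sum => k _; rewrite -[X in X <= _]real_normK ?num_real//.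
  rewrite lerXn2r ?nnegrE ?mulr_ge0//.
  apply: (le_trans (ler_normB _ _)); rewrite mulr_natl mulr2n.
  by apply: lerD; exact: dual_norm_ge.
have rD : \sum_k r k * D k = G y - F G + phi x.
  rewrite GyE FGE /phi -sumrB -big_split/=; apply: eq_bigr => k _.
  by rewrite /D /r; ring.
have := infS _ x'_le1; rewrite phix'.
have t2M : t ^+ 2 * \sum_k D k ^+ 2 <= t * d / 2.
  apply: (@le_trans _ _ (t ^+ 2 * M)); first by rewrite ler_wpM2l// sqr_ge0.
  have : t * (t * (2 * M + d)) = t * d by rewrite tE.
  have : 0 <= t * (t * d) by rewrite mulr_ge0// ltW.
  by rewrite expr2; lra.
have : t * (3 / 4 * d) <= t * \sum_k r k * D k.
  by rewrite ler_wpM2l ?(ltW t0)// rD; have := infS _ x1; lra.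
lra.
Qed.

(** Goldstine's theorem: an element of the unit ball of the bidual is
    approximated on finitely many functionals by elements of the unit ball. *)
Lemma goldstine (F : dual_space (dual_space V)) (h : nat -> dual_space V) n (e : R) :
  `|F| <= 1 -> 0 < e -> exists x, `|x| <= 1 /\
    forall k, (k < n)%N -> `|F (h k) - h k x| <= e.
Proof.
move=> F1 e0; have e20 : 0 < e ^+ 2 by rewrite exprn_gt0.
have [x x1 xe] := @goldstine_sum F n (fun k => h k) _ F1 e20.
exists x; split=> // k kn; rewrite -[leLHS]ger0_norm// -ler_sqr ?nnegrE ?(ltW e0)//.
rewrite normr_id real_normK ?num_real//; apply: le_trans (ltW xe).
rewrite (bigD1 (Ordinal kn))//= lerDl; apply: sumr_ge0 => j _; exact: sqr_ge0.
Qed.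

End goldstine.

(** * Weakly compact operators and almost diagonal matrices *)

Lemma finite_sums_bounded_cvg0 (R : realType) (a : nat -> R) (C : R) :
  (forall s, uniq s -> `|\sum_(k <- s) a k| <= C) -> a @ \oo --> 0.
Proof.
move=> aC; apply: norm_cvg0; apply: cvg_series_cvg_0.
apply: nondecreasing_is_cvgn.
  exact: nondecreasing_series.
exists (C + C) => _ [n _ <-]; rewrite /series/=.
rewrite (bigID (fun k => 0 <= a k))/= /index_iota subn0.
apply: lerD.
  rewrite (eq_bigr a) => [|k ak]; last by rewrite ger0_norm.
  rewrite -big_filter; apply: le_trans (ler_norm _) _; apply: aC.
  by rewrite filter_uniq// iota_uniq.
rewrite (eq_bigr (fun k => - a k)) => [|k ak]; last first.
  by rewrite ler0_norm// ltW// ltNge.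
rewrite sumrN -big_filter; apply: le_trans (ler_norm _) _; rewrite normrN; apply: aC.
by rewrite filter_uniq// iota_uniq.
Qed.

Lemma cvg_sum_seq (R : realType) (V : normedModType R) (I J : Type)
    (F : set_system I) (s : seq J) (u : I -> J -> V) (l : J -> V) :
  Filter F -> (forall k, u i k @[i --> F] --> l k) ->
  (\sum_(k <- s) u i k) @[i --> F] --> \sum_(k <- s) l k.
Proof.
move=> FF ul; elim: s => [|k s ih].
  rewrite big_nil (_ : (fun i => _) = (fun=> 0)); first exact: cvg_cst.
  by apply/funext => i; rewrite big_nil.
rewrite big_cons (_ : (fun i => _) = (fun i => u i k + \sum_(j <- s) u i j)).
  exact: cvgD.
by apply/funext => i; rewrite big_cons.
Qed.

Lemma filter_all_seq (T : eqType) (I : Type) (U : set_system I) (s : seq T)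
    (P : T -> I -> Prop) : Filter U ->
  (forall k, \forall i \near U, P k i) ->
  \forall i \near U, forall k, k \in s -> P k i.
Proof.
move=> UF UP; elim: s => [|k s ih]; first exact: nearW.
apply: filterS2 (UP k) ih => i Pki Pi j.
by rewrite inE => /predU1P[->//|]; exact: Pi.
Qed.

(** If the rows of an infinite matrix tend to zero and its columns converge,
    along a filter that contains the tails, to the terms of a null sequence,
    then some infinite principal submatrix has off-diagonal entries as small as
    desired. *)
Lemma select_off_diagonal (R : realType) (U : set_system nat)
    (a : nat -> nat -> R) (alpha : nat -> R) (e : R) :
  ProperFilter U -> \oo `<=` U -> 0 < e ->
  (forall m, a m @ \oo --> 0) -> alpha @ \oo --> 0 ->
  (forall k, a m k @[m --> U] --> alpha k) ->
  exists m : nat -> nat, {homo m : i j / (i < j)%N} /\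
    forall i j, i != j -> `|a (m i) (m j)| <= e / 2 ^+ j.+1.
Proof.
move=> UF ooU e0 a0 alpha0 aalpha.
(* an entry below the diagonal is within [eps] of its column limit, which is
   itself at most [eps] *)
pose eps (j : nat) := e / 2 ^+ j.+2.
have eps0 j : 0 < eps j by rewrite divr_gt0// exprn_gt0.
have epsD j : eps j + eps j = e / 2 ^+ j.+1.
  by rewrite /eps (exprS 2 j.+1) invfM; set q := (2 ^+ j.+1)^-1; lra.
have step (s : seq nat) : exists k, `|alpha k| <= eps (size s) /\
    forall i, i \in s -> [/\ (i < k)%N, `|a i k| <= eps (size s) &
      `|a k i - alpha i| <= eps (size s)].
  apply: (@filter_ex _ U); apply: filterI.
    by apply: ooU; apply: (cvgr0_norm_le _ alpha0); exact: eps0.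
  apply: filter_all_seq => i.
  have n1 : U [set k | (i < k)%N] by apply: ooU; exact: nbhs_infty_gt.
  have n2 : U [set k | `|a i k| <= eps (size s)].
    by apply: ooU; apply: (cvgr0_norm_le _ (a0 i)); exact: eps0.
  have n3 : U [set k | `|a k i - alpha i| <= eps (size s)].
    have /cvgrPdist_le/(_ _ (eps0 (size s))) := aalpha i.
    by apply: filterS => k /=; rewrite distrC.
  by apply: filterS3 n1 n2 n3 => k /= ik aik aki.
have [f fP] := choice step.
(* [hist n] lists the first [n] selected indices; the next one is [f] of it *)
pose hist := fix hist n := if n is n'.+1 then rcons (hist n') (f (hist n')) else [::].
have size_hist n : size (hist n) = n by elim: n => //= n ih; rewrite size_rcons ih.
pose m j := f (hist j).
have m_hist i j : (i < j)%N -> m i \in hist j.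
  elim: j => // j ih; rewrite ltnS leq_eqVlt /= mem_rcons inE.
  by move=> /predU1P[->|/ih ->]; rewrite ?eqxx ?orbT.
have epsS i j : (i <= j)%N -> eps j <= eps i.
  move=> ij; rewrite ler_wpM2l ?(ltW e0)// lef_pV2 ?posrE ?exprn_gt0//.
  by rewrite ler_eXn2l// ?ltr1n//.
exists m; split=> [i j /m_hist mij|i j].
  by have [] := (fP (hist j)).2 _ mij.
rewrite neq_lt => /orP[/m_hist mij|ji].
  have [_ h _] := (fP (hist j)).2 _ mij; apply: le_trans h _.
  by rewrite size_hist -epsD lerDl ltW.
have [_ _ h] := (fP (hist i)).2 _ (m_hist _ _ ji).
have := (fP (hist j)).1; rewrite !size_hist in h *.
move: h => /ler_normlP[h1 h2] /ler_normlP[h3 h4].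
by have := epsS _ _ (ltnW ji); rewrite -epsD ler_norml /m => h; lra.
Qed.

Lemma sum_geometric_half_le (R : realType) (e : R) n : 0 <= e ->
  \sum_(0 <= j < n) e / 2 ^+ j.+1 <= e.
Proof.
move=> e0; suff -> : \sum_(0 <= j < n) e / 2 ^+ j.+1 = e - e / 2 ^+ n.
  by rewrite gerBl divr_ge0// exprn_ge0.
elim: n => [|n ih]; first by rewrite big_nil expr0 divr1 subrr.
rewrite big_nat_recr//= ih exprS invfM.
set q := (2 ^+ n)^-1; lra.
Qed.

(** A weakly compact operator maps no array of vectors that resembles the bases
    of the finite-dimensional sup-norm spaces to vectors bounded away from zero.
    Weak limits [u k] of the columns of [T (z N k)] exist by compactness, and
    are weakly unconditionally summable. After passing to a subsequence for
    which the matrix [g m (u k)] is almost diagonal, the partial sums [y n] of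
    the [u k] have iterated limits of [g m (y n)] that differ. Along an
    ultrafilter they must agree: if [y] is the weak limit of the [y n] in the
    weakly compact set, and [G] the pointwise limit of the [g m], both are
    equal to [G y]. *)
Theorem weakly_compact_no_c0 (R : realType) (E Y : normedModType R)
    (T : {linear E -> Y}) (z : nat -> nat -> E) (g : nat -> dual_space Y)
    (delta : R) :
  weakly_compact_operator T ->
  (forall N s, uniq s -> `|\sum_(k <- s) z N k| <= 1) ->
  (forall k, `|g k| <= 1) -> 0 < delta ->
  ~ (forall N k, (k <= N)%N -> delta <= g k (T (z N k))).
Proof.
move=> [[M TM] Kc] z1 g1 d0 gz.
have [U [UU ooU]] := ultraFilterLemma (eventually_filter).
set K := closure _ in Kc.
have KT x : `|x| <= 1 -> K (T x) by move=> x1; apply: subset_closure; exists x.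
have TM' x : `|x| <= 1 -> `|T x| <= `|M|.
  move=> x1; apply: (le_trans (TM x)); apply: (@le_trans _ _ (`|M| * `|x|)).
    by rewrite ler_wpM2r// ler_norm.
  by rewrite -[leRHS]mulr1 ler_wpM2l.
have step (s : seq nat) : exists y : Y, uniq s -> K y /\
    forall f : dual_space Y, f (T (\sum_(k <- s) z N k)) @[N --> U] --> f y.
  have [us|_] := boolP (uniq s); last by exists 0.
  have [|y yP] := @weak_compact_ultra_lim R Y nat U K
    (fun N => T (\sum_(k <- s) z N k)) UU Kc; last by exists y.
  by move=> N; apply: KT; exact: z1.
have [l lP] := choice step.
(* [l s] is the weak limit of the images of the partial sums over [s]; it equals
   the sum of the [u k] over [s] as far as functionals can tell, and lies in
   [K] by construction *)
pose u k := l [:: k].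
have uP (f : dual_space Y) k : f (T (z N k)) @[N --> U] --> f (u k).
  have := (lP [:: k] isT).2 f.
  by under eq_fun do rewrite big_seq1.
have lE (f : dual_space Y) s : uniq s -> f (l s) = \sum_(k <- s) f (u k).
  move=> us; apply: (@cvg_unique R^o (@norm_hausdorff _ _)
    (f (T (\sum_(k <- s) z N k)) @[N --> U])).
    exact: (lP s us).2.
  rewrite (_ : (fun N => _) = (fun N => \sum_(k <- s) f (T (z N k)))); last first.
    by apply/funext => N; rewrite (linear_sum T) (linear_sum f).
  by apply: (@cvg_sum_seq R R^o) => k; exact: uP.
have lbound (f : dual_space Y) s : uniq s -> `|f (l s)| <= `|f| * `|M|.
  move=> us; apply: (@cvgr_to_le _ U _ _ (fun N => `|f (T (\sum_(k <- s) z N k)) : R^o|)).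
    by apply: cvg_norm; exact: (lP s us).2.
  apply: nearW => N; apply: (le_trans (dual_norm_bound _ _)).
  by apply: ler_wpM2l; [exact: (normr_ge0 f)|apply: TM'; exact: z1].
have u0 (f : dual_space Y) : f (u k) @[k --> \oo] --> (0 : R).
  apply: (@finite_sums_bounded_cvg0 _ _ (`|f| * `|M|)) => s us.
  by rewrite -lE//; exact: lbound.
have [G GP] := ultra_dual_lim UU ler01 g1.
have diag k : delta <= g k (u k).
  apply: (@cvgr_to_ge _ U _ _ _ _ _ (uP (g k) k)).
  have : U [set N | (k <= N)%N] by apply: ooU; exact: nbhs_infty_ge.
  by apply: filterS => N /= kN; exact: gz.
have d40 : 0 < delta / 4 by lra.
(* rows tend to zero by [u0], and so does the sequence of column limits
   [G (u k)] *)
have [m [m_incr mP]] := select_off_diagonal (a := fun m k => g m (u k)) _ ooU d40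
  (fun m => u0 (g m)) (u0 G) (fun k => GP (u k)).
pose s n := [seq m i | i <- index_iota 0 n].
have us n : uniq (s n).
  rewrite map_inj_uniq ?iota_uniq// => i j mij; apply/eqP; case: ltngtP => //.
    by move=> /m_incr; rewrite mij ltnn.
  by move=> /m_incr; rewrite mij ltnn.
have gl i n : g (m i) (l (s n)) = \sum_(0 <= j < n) g (m i) (u (m j)).
  by rewrite lE// /s big_map.
have off i n : (n <= i)%N -> g (m i) (l (s n)) <= delta / 4.
  move=> ni; rewrite gl; apply: le_trans (sum_geometric_half_le n (ltW d40)).
  apply: ler_sum_nat => j /andP[_ jn]; apply: (le_trans (ler_norm _)); apply: mP.
  by rewrite neq_ltn (leq_trans jn ni) orbT.
have on i n : (i < n)%N -> delta - delta / 4 <= g (m i) (l (s n)).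
  move=> ni; rewrite gl -lerN2 opprB.
  have := sum_geometric_half_le n (ltW d40).
  rewrite (bigD1_seq i) ?mem_index_iota ?iota_uniq//=.
  rewrite [in X in _ -> X](bigD1_seq i) ?mem_index_iota ?iota_uniq//=.
  have : - \sum_(0 <= j < n | j != i) g (m i) (u (m j)) <=
      \sum_(0 <= j < n | j != i) delta / 4 / 2 ^+ j.+1.
    rewrite -sumrN; apply: ler_sum => j ji.
    by apply: le_trans (ler_norm _) _; rewrite normrN; apply: mP; rewrite eq_sym.
  have : 0 <= delta / 4 / 2 ^+ i.+1 by rewrite divr_ge0 ?exprn_ge0// ltW.
  have := diag (m i); lra.
have [y [_ yP]] := @weak_compact_ultra_lim R Y nat U K (fun n => l (s n)) UU Kc
  (fun n => (lP (s n) (us n)).1).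
have [G' G'P] := ultra_dual_lim UU ler01 (fun i => g1 (m i)).
(* the two iterated limits, both equal to [G' y] *)
have big : delta - delta / 4 <= G' y.
  apply: (@cvgr_to_ge _ U _ _ _ _ _ (G'P y)); apply: nearW => i.
  apply: (@cvgr_to_ge _ U _ _ _ _ _ (yP (g (m i)))).
  have : U [set n | (i < n)%N] by apply: ooU; exact: nbhs_infty_gt.
  by apply: filterS => n; exact: on.
have small : G' y <= delta / 4.
  apply: (@cvgr_to_le _ U _ _ _ _ _ (yP G')); apply: nearW => n.
  apply: (@cvgr_to_le _ U _ _ _ _ _ (G'P (l (s n)))).
  have : U [set i | (n <= i)%N] by apply: ooU; exact: nbhs_infty_ge.
  by apply: filterS => i; exact: off.
lra.
Qed.

(** * Elementary theory of Banach lattices *)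

Section vector_lattice.
Variables (R : realType) (E : banachLatticeType R).
Implicit Types (x y z a b w : E).

(** The positive part; the negative part of [x] is [vpos (- x)]. *)
Definition vpos x : E := vsup x 0.

Lemma vleD x y z w : vle x y -> vle z w -> vle (x + z) (y + w).
Proof.
move=> xy zw; apply: (@vle_trans _ _ (y + z)); first exact: vleD2r.
by rewrite ![y + _]addrC; exact: vleD2r.
Qed.

Lemma subv_ge0 x y : vle 0 (y - x) <-> vle x y.
Proof.
split=> [/(vleD2r x)|/(vleD2r (- x))]; first by rewrite add0r subrK.
by rewrite subrr.
Qed.

Lemma vle_subl_addr x y z : vle (x - y) z <-> vle x (z + y).
Proof.
split=> [/(vleD2r y)|/(vleD2r (- y))]; first by rewrite subrK.
by rewrite addrK.
Qed.

Lemma oppv_le0 x : vle 0 x -> vle (- x) 0.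
Proof. by move=> x0; apply/subv_ge0; rewrite sub0r opprK. Qed.

Lemma vle_vsupl x y : vle x (vsup x y).
Proof. exact: ((vsup_leP x y _).1 (vle_refl _)).1. Qed.

Lemma vle_vsupr x y : vle y (vsup x y).
Proof. exact: ((vsup_leP x y _).1 (vle_refl _)).2. Qed.

Lemma vinf_vlel x y : vle (vinf x y) x.
Proof. exact: ((vle_infP x y _).1 (vle_refl _)).1. Qed.

Lemma vinf_vler x y : vle (vinf x y) y.
Proof. exact: ((vle_infP x y _).1 (vle_refl _)).2. Qed.

Lemma vpos_ge0 x : vle 0 (vpos x). Proof. exact: vle_vsupr. Qed.

Lemma vle_vpos x : vle x (vpos x). Proof. exact: vle_vsupl. Qed.

Lemma vpos_le x y : vle x y -> vle 0 y -> vle (vpos x) y.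
Proof. by move=> xy y0; apply/vsup_leP. Qed.

Lemma vpos_id x : vle 0 x -> vpos x = x.
Proof.
move=> x0; apply: vle_anti; last exact: vle_vpos.
by apply: vpos_le => //; exact: vle_refl.
Qed.

Lemma vposD x y : vle (vpos (x + y)) (vpos x + vpos y).
Proof.
apply: vpos_le; first by apply: vleD; exact: vle_vpos.
by rewrite -[0]addr0; apply: vleD; exact: vpos_ge0.
Qed.

Lemma vposZ (a : R) x : 0 <= a -> vle (vpos (a *: x)) (a *: vpos x).
Proof.
move=> a0; apply: vpos_le; first exact: vleZ2l a0 (vle_vpos x).
by rewrite -(scaler0 E a); exact: vleZ2l a0 (vpos_ge0 x).
Qed.

Lemma vpos_subN x : x = vpos x - vpos (- x).
Proof.
apply/eqP; rewrite eq_sym subr_eq addrC -subr_eq; apply/eqP/vle_anti.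
  apply/vle_subl_addr/vpos_le; last first.
    by apply/vle_subl_addr; rewrite sub0r; exact: vle_vpos.
  by rewrite -[X in vle X _]add0r; apply: vleD (vle_refl _); exact: vpos_ge0.
apply: vpos_le; last by apply/subv_ge0; exact: vle_vpos.
by rewrite -[X in vle X _]add0r; apply: vleD (vle_refl _); exact: vpos_ge0.
Qed.

Lemma vle_vabs x : vle x (vabs x). Proof. exact: vle_vsupl. Qed.

Lemma vleN_vabs x : vle (- x) (vabs x). Proof. exact: vle_vsupr. Qed.

Lemma vabs_ge0 x : vle 0 (vabs x).
Proof.
have := vleD (vle_vabs x) (vleN_vabs x); rewrite subrr => xx.
have h : (0 : R) <= 2^-1 by lra.
have := vleZ2l _ _ _ h xx; rewrite scaler0 -mulr2n -(scaler_nat 2 (vabs x)) scalerA.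
by rewrite mulVf ?scale1r.
Qed.

Lemma vpos_vabs x : vle (vpos x) (vabs x).
Proof. by apply: vpos_le; [exact: vle_vabs|exact: vabs_ge0]. Qed.

Lemma vposN_vabs x : vle (vpos (- x)) (vabs x).
Proof. by apply: vpos_le; [exact: vleN_vabs|exact: vabs_ge0]. Qed.

Lemma ler_norm_vabs x y : vle 0 x -> vle x (vabs y) -> `|x| <= `|y|.
Proof.
move=> x0 xy; apply: lattice_norm; apply/vsup_leP; split=> //.
exact: vle_trans (oppv_le0 x0) (vabs_ge0 y).
Qed.

Lemma riesz_decomposition z a b : vle 0 z -> vle 0 a -> vle 0 b ->
  vle z (a + b) ->
  exists z1 z2, [/\ z = z1 + z2, vle 0 z1 /\ vle 0 z2 & vle z1 a /\ vle z2 b].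
Proof.
move=> z0 a0 b0 zab; exists (vinf z a), (z - vinf z a).
split; first by rewrite addrC subrK.
  by split; [apply/vle_infP|apply/subv_ge0; exact: vinf_vlel].
split; first exact: vinf_vler.
apply/vle_subl_addr; rewrite addrC; apply/vle_subl_addr/vle_infP.
split; last exact/vle_subl_addr.
by apply/vle_subl_addr; rewrite -{1}[z]addr0; exact: vleD (vle_refl _) b0.
Qed.

(** Disjointness, intended for positive [x] and [y], for which it amounts to
    [vinf x y = 0]. *)
Definition vdisjoint x y := vle (vinf x y) 0.

Lemma vdisjointS x y x' y' :
  vdisjoint x y -> vle x' x -> vle y' y -> vdisjoint x' y'.
Proof.
move=> xy xx yy; apply: vle_trans xy; apply/vle_infP.
by split; [exact: vle_trans (vinf_vlel _ _) xx|exact: vle_trans (vinf_vler _ _) yy].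
Qed.

Lemma vdisjointZ (k : R) x y : 0 < k -> vdisjoint x y ->
  vdisjoint (k *: x) (k *: y).
Proof.
move=> k0 xy; have kV0 : 0 <= k^-1 by rewrite invr_ge0 ltW.
have kK z : k^-1 *: (k *: z) = z by rewrite scalerA mulVf ?gt_eqF// scale1r.
rewrite /vdisjoint; set w := vinf _ _.
have w0 : vle (k^-1 *: w) 0.
  apply: vle_trans xy; apply/vle_infP; split.
    by rewrite -[X in vle _ X]kK; apply: vleZ2l => //; exact: vinf_vlel.
  by rewrite -[X in vle _ X]kK; apply: vleZ2l => //; exact: vinf_vler.
have := vleZ2l _ _ _ (ltW k0) w0.
by rewrite scaler0 scalerA mulfV ?gt_eqF// scale1r.
Qed.

Lemma vleZ2r (k l : R) x : vle 0 x -> k <= l -> vle (k *: x) (l *: x).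
Proof.
move=> x0 kl; apply/subv_ge0; rewrite -scalerBl -(scaler0 E (l - k)).
by apply: vleZ2l => //; rewrite subr_ge0.
Qed.

(** Elements of the principal ideals generated by two disjoint positive
    elements are disjoint. *)
Lemma vdisjoint_ideal (k l : R) x y z z' : vle 0 x -> vle 0 y ->
  vdisjoint x y -> vle z (k *: x) -> vle z' (l *: y) -> vdisjoint z z'.
Proof.
move=> x0 y0 xy zx z'y.
have K0 : 0 < `|k| + `|l| + 1 by rewrite ltr_wpDl// addr_ge0.
have := vdisjointZ K0 xy; move/vdisjointS; apply.
  apply: vle_trans zx _; apply: vleZ2r => //.
  by have := ler_norm k; have := normr_ge0 l; lra.
apply: vle_trans z'y _; apply: vleZ2r => //.
by have := ler_norm l; have := normr_ge0 k; lra.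
Qed.

Lemma vdisjointD a b c : vle 0 a -> vle 0 b -> vle 0 c ->
  vdisjoint a c -> vdisjoint b c -> vdisjoint (a + b) c.
Proof.
move=> a0 b0 c0 ac bc; rewrite /vdisjoint; set w := vinf _ _.
have w0 : vle 0 w.
  by apply/vle_infP; split=> //; rewrite -[0]addr0; exact: vleD.
have [w1 [w2 [ww [w10 w20] [w1a w2b]]]] :=
  riesz_decomposition w0 a0 b0 (vinf_vlel _ _).
have wc : vle w c by exact: vinf_vler.
rewrite ww -[X in vle _ X]addr0; apply: vleD.
  apply: vle_trans ac; apply/vle_infP; split=> //; apply: vle_trans wc.
  by rewrite ww -{1}[w1]addr0; exact: vleD (vle_refl _) w20.
apply: vle_trans bc; apply/vle_infP; split=> //; apply: vle_trans wc.
by rewrite ww -{1}[w2]add0r; exact: vleD w10 (vle_refl _).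
Qed.

Lemma sumv_ge0 (z : nat -> E) (s : seq nat) :
  (forall k, vle 0 (z k)) -> vle 0 (\sum_(k <- s) z k).
Proof.
move=> z0; elim: s => [|k s ih]; first by rewrite big_nil; exact: vle_refl.
by rewrite big_cons -[X in vle X _]addr0; exact: vleD.
Qed.

(** The sum of pairwise disjoint positive elements is their supremum. *)
Lemma vdisjoint_sum_le (z : nat -> E) y (s : seq nat) : uniq s ->
  (forall k, vle 0 (z k)) -> (forall k, vle (z k) y) -> vle 0 y ->
  (forall k l, k != l -> vdisjoint (z k) (z l)) ->
  vle (\sum_(k <- s) z k) y.
Proof.
move=> us z0 zy y0 zd.
have sum_disj (t : seq nat) l : l \notin t -> vdisjoint (\sum_(k <- t) z k) (z l).
  elim: t => [_|k t ih]; first by rewrite big_nil; exact: vinf_vlel.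
  rewrite inE negb_or => /andP[lk lt]; rewrite big_cons.
  by apply: vdisjointD => //; [exact: sumv_ge0|apply: zd; rewrite eq_sym|exact: ih].
elim: s us => [_|k s ih /= /andP[ks us]]; first by rewrite big_nil.
have {}ih := ih us.
(* if [S] and [z k] are disjoint and both below [y], then [S + z k - y] is
   below both of them *)
have := sum_disj s k ks; rewrite big_cons addrC.
set S := \sum_(j <- s) z j in ih * => Sk.
rewrite -[y]add0r; apply/vle_subl_addr; apply: vle_trans Sk; apply/vle_infP.
split; apply/vle_subl_addr; first exact: vleD (vle_refl _) (zy k).
by rewrite [X in vle X _]addrC; exact: vleD (vle_refl _) ih.
Qed.

End vector_lattice.

(** * Components of functionals on principal ideals *)

Section ideal_part.
Variables (R : realType) (E : banachLatticeType R) (f : dual_space E) (w : E).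
Hypothesis w0 : vle 0 w.

(** The positive elements below the positive part of [x] that lie in the
    principal ideal generated by [w]. *)
Definition ideal_below (x : E) : set E :=
  [set z | [/\ vle 0 z, vle z (vpos x) & exists k : R, vle z (k *: w)]].

(** On positive [x], the value at [x] of the part of the positive part of [f]
    carried by the ideal generated by [w]. The positive part of [x] makes it
    sublinear on the whole space, so that the Hahn-Banach theorem yields a
    linear functional without extending from the positive cone. *)
Definition ideal_sup (x : E) : R := sup [set f z | z in ideal_below x].

Let below_bound x z : ideal_below x z -> `|f z| <= `|f| * `|x|.
Proof.
move=> [z0 zx _]; apply: (le_trans (dual_norm_bound f z)).
apply: ler_wpM2l; first exact: (normr_ge0 f).
by apply: ler_norm_vabs => //; exact: vle_trans zx (vpos_vabs x).
Qed.

Let below0 x : ideal_below x 0.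
Proof.
split; [exact: vle_refl|exact: vpos_ge0|exists 0].
by rewrite scale0r; exact: vle_refl.
Qed.

Let has_sup_below x : has_sup [set f z | z in ideal_below x].
Proof.
split; first by exists (f 0); exists 0 => //; exact: below0.
exists (`|f| * `|x|) => _ [z zx <-].
exact: le_trans (ler_norm _) (below_bound zx).
Qed.

Let le_ideal_sup x z : ideal_below x z -> f z <= ideal_sup x.
Proof.
by move=> zx; apply: sup_upper_bound; [exact: has_sup_below|exists z].
Qed.

Let ideal_sup_le x c : (forall z, ideal_below x z -> f z <= c) -> ideal_sup x <= c.
Proof.
move=> fc; apply: ge_sup; first exact: (has_sup_below x).1.
by move=> _ [z zx <-]; exact: fc.
Qed.

Lemma ideal_sup_sublinear : sublinear ideal_sup.
Proof.
split=> [x y|a x a0]; apply: ideal_sup_le => z [z0 zxy [k zk]].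
  have [z1 [z2 [zE [z10 z20] [z1x z2y]]]] := riesz_decomposition z0
    (vpos_ge0 x) (vpos_ge0 y) (vle_trans _ _ _ zxy (vposD x y)).
  rewrite zE linearD; apply: lerD; apply: le_ideal_sup; split=> //; exists k;
    apply: vle_trans zk; rewrite zE.
    by rewrite -[X in vle X _]addr0; exact: vleD (vle_refl _) z20.
  by rewrite -[X in vle X _]add0r; exact: vleD z10 (vle_refl _).
have aV0 : 0 <= a^-1 by rewrite invr_ge0 ltW.
have aK (v : E) : a^-1 *: (a *: v) = v by rewrite scalerA mulVf ?gt_eqF// scale1r.
rewrite -ler_pdivrMl//.
have <- : f (a^-1 *: z) = a^-1 * f z by rewrite linearZ.
apply: le_ideal_sup; split.
- by rewrite -(scaler0 E a^-1); exact: vleZ2l.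
- rewrite -(aK (vpos x)); apply: vleZ2l => //.
  exact: vle_trans zxy (vposZ x (ltW a0)).
- by exists (a^-1 * k); rewrite -scalerA; exact: vleZ2l.
Qed.

(** A positive functional that is at least [f] at [w], and any of whose values
    is nearly attained by [f] at a positive element of the ideal of [w]. *)
Lemma ideal_functional : exists h : dual_space E,
  [/\ vle 0 h, f w <= h w & forall x c, c < h x ->
    exists z, [/\ vle 0 z, vle z (vpos x), (exists k : R, vle z (k *: w)) & c < f z]].
Proof.
have [h [hle hw]] := hahn_banach_sublinear w ideal_sup_sublinear.
have ideal_sup_bound x : ideal_sup x <= `|f| * `|x|.
  by apply: ideal_sup_le => z /below_bound; exact: le_trans (ler_norm _).
have hb x : `|h x| <= `|f| * `|x|.
  rewrite ler_norml (le_trans (hle x))// andbT lerNl -(normrN x).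
  by have := le_trans (hle (- x)) (ideal_sup_bound (- x)); rewrite linearN.
have [h' [h'E _]] := dual_of_bounded (normr_ge0 f) hb.
exists h'; split.
- move=> x x0; rewrite h'E -[leRHS]opprK oppr_ge0 -[- h x]linearN.
  apply: (le_trans (hle _)); apply: ideal_sup_le => z [z0 zx _].
  suff -> : z = 0 by rewrite linear0.
  apply: vle_anti => //; apply: vle_trans zx _; apply: vpos_le (vle_refl _).
  exact: oppv_le0.
- rewrite h'E hw; apply: le_ideal_sup; split=> //.
    by rewrite vpos_id//; exact: vle_refl.
  by exists 1; rewrite scale1r; exact: vle_refl.
- move=> x c; rewrite h'E => /lt_le_trans/(_ (hle x)) /sup_gt.
  move=> /(_ (has_sup_below x).1)[_ [z [z0 zx zk] <-] cz].
  by exists z.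
Qed.

End ideal_part.

(** * Operators on disjoint sequences *)

Lemma dual_comp (R : realType) (E Y : normedModType R) (T : {linear E -> Y})
    (f : dual_space Y) : bounded_operator T ->
  exists g : dual_space E, forall x, g x = f (T x).
Proof.
move=> [M TM]; pose fT : {linear E -> R^o} := f \o T.
have [|x|g [gE _]] := @dual_of_bounded R E fT (`|f| * `|M|); last by exists g.
  by rewrite mulr_ge0//; exact: (normr_ge0 f).
apply: (le_trans (dual_norm_bound f _)); rewrite -mulrA.
apply: ler_wpM2l; first exact: (normr_ge0 f).
by apply: (le_trans (TM x)); rewrite ler_wpM2r// ler_norm.
Qed.

Lemma bounded_operator_weakly_null (R : realType) (E Y : normedModType R)
    (T : {linear E -> Y}) (x : nat -> E) : bounded_operator T ->
  weakly_cvg x 0 -> weakly_cvg (T \o x) 0.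
Proof.
move=> Tb /weakly_cvgP x0; apply/weakly_cvgP => f.
have [g gE] := dual_comp f Tb.
by have := x0 g; rewrite gE linear0; under eq_fun do rewrite gE.
Qed.

Lemma not_cvg0_subsequence (R : realType) (a : nat -> R) :
  ~ (a @ \oo --> 0) -> exists phi : nat -> nat,
    injective phi /\ exists2 e, 0 < e & forall k, e < `|a (phi k)|.
Proof.
move=> na.
have [e e0 ae] : exists2 e, 0 < e & forall N, exists n, (N <= n)%N /\ e < `|a n|.
  apply: contrapT => h; apply: na; apply/cvgr0Pnorm_le => e e0.
  apply: contrapT => h'; apply: h; exists e => // N.
  apply: contrapT => h; apply: h'; exists N => // n /= Nn.
  by rewrite leNgt; apply/negP => en; apply: h; exists n.
have [psi psiP] := choice ae.
pose phi := fix phi k := if k is k'.+1 then psi (phi k').+1 else psi 0%N.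
have phi_incr : {homo phi : i j / (i < j)%N}.
  apply: homo_ltn; first exact: ltn_trans.
  by move=> i; exact: (psiP _).1.
exists phi; split; last by exists e => // -[|k]; exact: (psiP _).2.
move=> i j ij; apply/eqP; case: ltngtP => // /phi_incr; by rewrite ij ltnn.
Qed.

(** A weakly compact operator from [E] maps bounded disjoint positive sequences
    to norm-null sequences when the dual of [E] has the positive Schur
    property. *)
Theorem weakly_compact_disjoint_null (R : realType) (E : banachLatticeType R)
    (Y : normedModType R) (T : {linear E -> Y}) (x : nat -> E) (M : R) :
  positive_schur (dual_space E) -> weakly_compact_operator T ->
  (forall n, vle 0 (x n)) -> (forall n m, n != m -> vdisjoint (x n) (x m)) ->
  (forall n, `|x n| <= M) -> (fun n => T (x n)) @ \oo --> 0.
Proof.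
move=> Eschur Tc x0 xd xM.
have [g gP] := choice (fun n => dual_norming (T (x n))).
have [f fE] := choice (fun n => dual_comp (g n) Tc.1).
have [h hP] := choice (fun n => ideal_functional (f n) (x0 n)).
(* as [`|T (x n)| <= h n (x n) <= `|h n| * M], it suffices that [h] is norm
   null, and, by the positive Schur property, weakly null *)
suff h0 : weakly_cvg h 0.
  have {}h0 := Eschur h (fun n => let: And3 p _ _ := hP n in p) h0.
  apply: norm_cvg0; apply: (@squeeze_cvgr _ _ _ _ (fun=> 0) (fun n => `|h n| * M)).
  - apply: nearW => n; rewrite normr_ge0/=; have [_ hx _] := hP n.
    rewrite -(gP n).2 -fE; apply: (le_trans hx); apply: (le_trans (ler_norm _)).
    apply: (le_trans (dual_norm_bound _ _)).
    by apply: ler_wpM2l; [exact: (normr_ge0 (h n))|exact: xM].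
  - exact: cvg_cst.
  - rewrite -[X in _ --> X](mul0r M); apply: cvgM; last exact: cvg_cst.
    by rewrite -(@normr0 R (dual_space E)); apply: cvg_norm.
apply/weakly_cvgP => F; rewrite linear0; apply: contrapT.
move=> /not_cvg0_subsequence[phi [phi_inj [e e0 Fe]]].
have nF0 : 0 < `|F| + 1 by rewrite ltr_wpDl//; exact: (normr_ge0 F).
pose F1 := (`|F| + 1)^-1 *: F; pose d := (`|F| + 1)^-1 * e.
have d0 : 0 < d by rewrite mulr_gt0// invr_gt0.
have F1_le1 : `|F1| <= 1.
  by rewrite normrZ gtr0_norm ?invr_gt0// ler_pdivrMl// mulr1 lerDl.
have F1d k : d < `|F1 (h (phi k))|.
  rewrite -[F1 _]/((`|F| + 1)^-1 * F (h (phi k))) normrM gtr0_norm ?invr_gt0//.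
  by rewrite ltr_pM2l ?invr_gt0//; exact: Fe.
have d20 : 0 < d / 2 by rewrite divr_gt0.
(* a unit-ball element [v N] on which the first [N.+1] functionals are at least
   [d / 2] in absolute value *)
have [v vP] := choice (fun N =>
  goldstine (fun k => h (phi k)) N.+1 F1_le1 d20).
(* for [i > N] no lower bound is needed, and [0] serves *)
have zex (p : nat * nat) : exists z, [/\ vle 0 z, vle z (vabs (v p.1)),
    (exists k : R, vle z (k *: x (phi p.2))) &
    ((p.2 <= p.1)%N -> d / 3 <= g (phi p.2) (T z))].
  case: p => N i /=; have [iN|_] := boolP (i <= N)%N; last first.
    exists 0; split=> //; [exact: vle_refl|exact: vabs_ge0|exists 0].
    by rewrite scale0r; exact: vle_refl.
  have := (vP N).2 i iN; have := F1d i; have [_ _ hz] := hP (phi i).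
  have [hv _ Fhv|hv Fh Fhv] := ltP (d / 3) (h (phi i) (v N)).
    have [z [z0 zv zk fz]] := hz _ _ hv; exists z; split=> //.
      exact: vle_trans zv (vpos_vabs _).
    by move=> _; rewrite -fE ltW.
  have hvN : d / 3 < h (phi i) (- v N).
    rewrite (linearN (h (phi i)))/=.
    move: Fh Fhv; rewrite ltr_normr ler_norml => Fh /andP[Fhv1 Fhv2].
    by case/orP: Fh => Fh; lra.
  have [z [z0 zv zk fz]] := hz _ _ hvN; exists z; split=> //.
    exact: vle_trans zv (vposN_vabs _).
  by move=> _; rewrite -fE ltW.
have [z zP] := choice zex.
apply: (@weakly_compact_no_c0 R E Y T (fun N k => z (N, k))
  (fun k => g (phi k)) (d / 3)) => //.
- move=> N s us; apply: le_trans (vP N).1; apply: ler_norm_vabs.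
    by apply: sumv_ge0 => k; have [] := zP (N, k).
  apply: vdisjoint_sum_le => //.
  + by move=> k; have [] := zP (N, k).
  + by move=> k; have [] := zP (N, k).
  + exact: vabs_ge0.
  + move=> k l kl; have [_ _ [c zc] _] := zP (N, k).
    have [_ _ [c' zc'] _] := zP (N, l).
    apply: vdisjoint_ideal zc zc' => //; apply: xd.
    by apply: contra_neq kl => /phi_inj.
- by move=> k; exact: (gP _).1.
- lra.
- by move=> N k kN; have [_ _ _] := zP (N, k); exact.
Qed.

Lemma cesaro_seq_cvg (R : realType) (V : normedModType R) (y : nat -> V) (l : V) :
  y @ \oo --> l -> cesaro_seq y @ \oo --> l.
Proof.
move=> yl; apply/cvgrPdist_le => e e0.
have : (fun n => `|l - y n| : R) @ \oo --> (0 : R).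
  rewrite -(@normr0 R V) -(subrr l); apply: cvg_norm; apply: cvgB => //.
  exact: cvg_cst.
move=> /cesaro/cvgr0Pnorm_le/(_ _ e0); apply: filterS => m.
apply: le_trans; rewrite /arithmetic_mean /cesaro_seq /series/=.
rewrite -[l in leLHS](@scalerK R V m.+1%:R)//.
rewrite -scalerBr normrZ normrM ler_wpM2l//.
rewrite [leRHS]ger0_norm ?sumr_ge0//; apply: le_trans (ler_norm_sum _ _ _).
by rewrite sumrB sumr_const_nat subn0 scaler_nat.
Qed.

Theorem theorem3p27 (R : realType)
    (E : banachLatticeType R) (Y : completeNormedModType R) :
  positive_schur (dual_space E) \/ schur Y ->
  forall T : {linear E -> Y},
    weakly_compact_operator T -> disjoint_weak_banach_saks T.
Proof.
move=> hyp T Tc; split; first exact: Tc.1.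
move=> x xd xw; exists id; split=> //.
suff [l Tl] : exists l : Y, (fun n => T (x n)) @ \oo --> l.
  by apply/cvg_ex; exists l; exact: cesaro_seq_cvg.
case: hyp => [Eschur|Yschur]; last first.
  apply/cvg_ex; apply: (Yschur _ 0).
  exact: bounded_operator_weakly_null Tc.1 xw.
have [M _ xM] := weakly_null_bounded xw.
have xvd n m : n != m -> vdisjoint (vabs (x n)) (vabs (x m)).
  by move=> nm; rewrite /vdisjoint xd//; exact: vle_refl.
have T0 (q : E -> E) : (forall v, vle 0 (q v)) -> (forall v, vle (q v) (vabs v)) ->
    (fun n => T (q (x n))) @ \oo --> 0.
  move=> q0 qv; apply: (weakly_compact_disjoint_null Eschur Tc (M := M)).
  - by move=> n; exact: q0.
  - by move=> n m nm; apply: vdisjointS (xvd n m nm) _ _; exact: qv.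
  - by move=> n; apply: le_trans (xM n); apply: ler_norm_vabs; [exact: q0|exact: qv].
exists 0; rewrite (_ : (fun n => _) =
    (fun n => T (vpos (x n)) - T (vpos (- x n)))); last first.
  by apply/funext => n; rewrite {1}[x n]vpos_subN linearB.
rewrite -[X in _ --> X](subr0 0); apply: cvgB.
  by apply: T0; [exact: vpos_ge0|exact: vpos_vabs].
apply: (T0 (fun v => vpos (- v))) => v; [exact: vpos_ge0|exact: vposN_vabs].
Qed.
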